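(* Let $A_1=P_1J_1P_1^{-1}$ with $J_1=\mathrm{diag}(-p_1,-q_1)$, $0<p_1<q_1$, and $A_2=P_2J_2P_2^{-1}$ with $J_2=\mathrm{diag}(p_2,q_2)$, where either $0<p_2<q_2$ or $p_2\le 0<q_2$; here $P_1,P_2$ are real invertible $2\times 2$ matrices chosen such that $M=P_2^{-1}P_1=\begin{pmatrix}a&b\\c&d\end{pmatrix}$ has determinant $1$. Suppose all entries of $M$ are nonzero and $\frac{abcd}{|abcd|}=1$ (equivalently $ad<0$ or $ad>1$). Let $\eta>0$ be given. (i) If $ad<0$, let $\tau_{1,2}(\eta)$ be the unique positive solution $t$ of $$\frac{\left(e^{q_2\eta-p_1t}-1\right)\left(1+e^{p_2\eta-q_1t}\right)}{\left(e^{-p_1t}+e^{-q_1t}\right)\left(e^{q_2\eta}-e^{p_2\eta}\right)}=ad.$$ (ii) If $ad>1$, let $\tau_{1,2}(\eta)=\max\left(\frac{p_2}{p_1}\eta,\,T(\eta)\right)$, where $T(\eta)$ is the unique positive solution $t$ of $$\frac{\left(1+e^{q_2\eta-p_1t}\right)\left(1-e^{p_2\eta-q_1t}\right)}{\left(e^{-p_1t}+e^{-q_1t}\right)\left(e^{q_2\eta}-e^{p_2\eta}\right)}=ad.$$ Then the switched system $\dot x(t)=A_{\sigma(t)}x(t)$ is stable for all signals $\sigma\in\mathcal S[\tau_{1,2}(\eta),\eta]$ and asymptotically stable for all signals $\sigma\in\mathcal S'[\tau_{1,2}(\eta),\eta]$.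
   Context: Planar switched system: $\dot x(t)=A_{\sigma(t)}x(t)$, $x(t)\in\mathbb R^2$ continuous in $t\ge0$, with $A_1,A_2$ real $2\times2$ matrices. A switching signal $\sigma:[0,\infty)\to\{1,2\}$ is right-continuous and piecewise constant with infinitely many discontinuities $0<d_1<d_2<\cdots$, $d_k\to\infty$; set $d_0=0$. For a signal with $\sigma(0)=1$ put $t_k=d_{2k-1}-d_{2k-2}$ (times spent in $A_1$) and $s_k=d_{2k}-d_{2k-1}$ (times spent in $A_2$), $k\ge1$. For $\tau,\eta>0$, $\mathcal S[\tau,\eta]$ is the set of signals with $\sigma(0)=1$, $t_k\ge\tau$ and $s_k\le\eta$ for all $k\in\mathbb N$; $\mathcal S'[\tau,\eta]$ is the set of $\sigma\in\mathcal S[\tau,\eta]$ for which the sequence $(t_k,s_k)_{k\ge1}$ does not converge to $(\tau,\eta)$. For a given signal $\sigma$, the system is stable if for every $\varepsilon'>0$ there is $\delta>0$ such that $\|x(0)\|<\delta$ implies $\|x(t)\|<\varepsilon'$ for all $t>0$; it is asymptotically stable if it is stable and $\|x(t)\|\to0$ as $t\to\infty$ for every $x(0)\in\mathbb R^2$. Norms are Euclidean. *)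

(* Defs.v *)
From HB Require Import structures.
From mathcomp Require Import all_boot all_order all_algebra.
From mathcomp Require Import all_classical all_reals all_analysis.

Set Implicit Arguments.
Unset Strict Implicit.
Unset Printing Implicit Defensive.

Import Order.TTheory GRing.Theory Num.Theory.
Import numFieldNormedType.Exports.

Local Open Scope classical_set_scope.
Local Open Scope ring_scope.

Variant mode := mode1 | mode2.

Definition subsystem (R : realType) (A1 A2 : 'M[R]_2) (m : mode) : 'M[R]_2 :=
  match m with mode1 => A1 | mode2 => A2 end.

Definition diag2 (R : realType) (u v : R) : 'M[R]_2 :=
  diag_mx (\row_(i < 2) if i == 0 then u else v).

(* The library norm on matrices is the sup norm. *)
Definition enorm (R : realType) (v : 'cV[R]_2) : R :=
  Num.sqrt (\sum_(i < 2) v i 0 ^+ 2).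

(* The values [d k.+1] are exactly the discontinuities of [sigma] on the half
   line of nonnegative times; the half-open intervals encode right-continuity.
   Values of [sigma] (and of solutions) at negative times are irrelevant. *)
Definition switching_times (R : realType) (sigma : R -> mode) (d : nat -> R)
    : Prop :=
  [/\ d 0%N = 0,
      (forall k, d k < d k.+1),
      d k @[k --> \oo] --> +oo,
      (forall k t, d k <= t < d k.+1 -> sigma t = sigma (d k)) &
      (forall k, sigma (d k.+1) <> sigma (d k))].

(* [dwell d k] and [flee d k] are t_(k+1) and s_(k+1). *)
Definition dwell (R : realType) (d : nat -> R) (k : nat) : R :=
  d k.*2.+1 - d k.*2.

Definition flee (R : realType) (d : nat -> R) (k : nat) : R :=
  d k.*2.+2 - d k.*2.+1.

Definition admissible (R : realType) (tau eta : R) (sigma : R -> mode)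
    (d : nat -> R) : Prop :=
  [/\ switching_times sigma d,
      sigma 0 = mode1,
      (forall k, tau <= dwell d k) &
      (forall k, flee d k <= eta)].

Definition signals (R : realType) (tau eta : R) : set (R -> mode) :=
  [set sigma | exists d, admissible tau eta sigma d].

(* The sequence [d] is determined by [sigma], so the quantifier is harmless. *)
Definition signals' (R : realType) (tau eta : R) : set (R -> mode) :=
  [set sigma | exists2 d, admissible tau eta sigma d &
     ~ ((dwell d k, flee d k) @[k --> \oo] --> (tau, eta))].

(* The equation is imposed at every positive time that is not a switching
   time; at switching times only continuity of [x] is required. *)
Definition solution (R : realType) (A : mode -> 'M[R]_2) (sigma : R -> mode)
    (x : R -> 'cV[R]_2) : Prop :=
  {within `[0, +oo[, continuous x} /\
  (forall t : R, 0 < t -> (\forall u \near t, sigma u = sigma t) ->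
     is_derive t 1 x (A (sigma t) *m x t)).

Definition stable (R : realType) (A : mode -> 'M[R]_2) (sigma : R -> mode)
    : Prop :=
  forall eps : R, 0 < eps -> exists2 delta : R, 0 < delta &
    forall x, solution A sigma x -> enorm (x 0) < delta ->
      forall t : R, 0 < t -> enorm (x t) < eps.

Definition asymptotically_stable (R : realType) (A : mode -> 'M[R]_2)
    (sigma : R -> mode) : Prop :=
  stable A sigma /\
  (forall x, solution A sigma x -> enorm (x t) @[t --> +oo] --> 0).

Definition stable_from (R : realType) (A : mode -> 'M[R]_2) (tau eta : R)
    : Prop :=
  (forall sigma, signals tau eta sigma -> stable A sigma) /\
  (forall sigma, signals' tau eta sigma -> asymptotically_stable A sigma).

(* Main.v *)
Require Import Defs.
From HB Require Import structures.
From mathcomp Require Import all_boot all_order all_algebra.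
From mathcomp Require Import all_classical all_reals all_analysis.
From mathcomp Require Import ring lra.

Set Implicit Arguments.
Unset Strict Implicit.
Unset Printing Implicit Defensive.

Import Order.TTheory GRing.Theory Num.Theory.
Import numFieldNormedType.Exports.

Local Open Scope classical_set_scope.
Local Open Scope ring_scope.

(** Over one period, time t in mode 1 followed by time s in mode 2 acts on the
    eigencoordinates y = P1^-1 x by the matrix N_s diag (e^(-p1 t), e^(-q1 t)),
    where N_s = M^-1 diag (E, F) M with E = e^(p2 s), F = e^(q2 s).  Writing
    D = ad and G = D (D - 1), the hypothesis on abcd says G > 0, that is, the
    two off-diagonal entries of N_s have opposite signs.  A diagonal rescaling
    then makes them opposite, so that N_s diag (1, -1) is symmetric.

    Fix the threshold tau, put al = e^(-p1 tau), be = e^(-q1 tau), and measure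
    y by the quadratic form V with weights proportional to al and be.  In
    coordinates where V is the Euclidean norm squared, the period map with
    t = tau is S diag (1, -1), where S is symmetric with
    det S = - al be E F < 0; its operator norm is therefore the spectral radius
    of S, and it is at most 1 as soon as the characteristic polynomial of S is
    nonnegative at 1 and at -1.  These two values are [gap_pos] and [gap_neg].
    The equations that define the thresholds say that [gap_pos] (if D < 0) or
    [gap_neg] (if D > 1) vanishes at s = eta.  So V is a quadratic Lyapunov
    function for the period maps ([period_map_contracts]).

    Two monotonicity facts turn this one equation into what is needed.  In the
    dwell time t, each gap is strictly positive once it has been nonnegative
    ([gap_pos_dwell], [gap_neg_dwell]), which makes the threshold unique.  In
    the flee time s, nonnegativity at s = eta propagates to all smaller s, and
    strictly ([flee_safe_neg], [flee_safe_pos]); the maximum with p2 eta / p1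
    in the case D > 1 is what makes [gap_pos] nonnegative too.  Since a dwell
    time beyond tau only adds the contraction of mode 1, V never exceeds its
    value at the beginning of a period, which gives stability.  If (t_k, s_k)
    does not tend to (tau, eta), then infinitely often t_k >= tau + e or
    s_k <= eta - e, and each such period multiplies V by at most a constant
    c < 1 ([stable_from_flee_safe]), hence V tends to 0. *)

(** * Contraction of one period *)

(** A positive semidefinite 2 x 2 matrix of trace at most 2 is bounded below by
    half its determinant times the identity; here the identity is replaced by
    diag (m, n). *)
Lemma weighted_form_coercive (R : realFieldType) (m n p q e w1 w2 : R) :
  0 < m -> 0 < n -> 0 <= p -> 0 <= q -> p + q <= 2 ->
  0 <= p * q - m * n * e ^+ 2 ->
  (p * q - m * n * e ^+ 2) / 2 * (m * w1 ^+ 2 + n * w2 ^+ 2) <=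
  m * p * w1 ^+ 2 + 2 * (m * n * e) * w1 * w2 + n * q * w2 ^+ 2.
Proof.
move=> m0 n0 p0 q0 pq2; set g := p * q - _ => g0.
have mn0 : 0 < m * n by apply: mulr_gt0.
have e0 : 0 <= m * n * e ^+ 2 by rewrite mulr_ge0 ?sqr_ge0 ?ltW.
have gpq : g <= p * q by rewrite /g; lra.
pose p' := p - g / 2; pose q' := q - g / 2.
have p'0 : 0 <= p' by rewrite /p'; nra.
have q'0 : 0 <= q' by rewrite /q'; nra.
have gg : 0 <= g * (2 - (p + q)) by rewrite mulr_ge0 // subr_ge0.
have disc : m * n * e ^+ 2 <= p' * q'.
  have -> : p' * q' = m * n * e ^+ 2 + g * (2 - (p + q)) / 2 + (g / 2) ^+ 2.
    by rewrite /p' /q' /g; field.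
  have := sqr_ge0 (g / 2); lra.
rewrite -subr_ge0.
rewrite [leRHS](_ : _ = m * p' * w1 ^+ 2 + 2 * (m * n * e) * w1 * w2 + n * q' * w2 ^+ 2);
  last by rewrite /p' /q'; field.
(* Complete the square, unless the leading coefficient vanishes. *)
have [p'z|p'nz] := eqVneq p' 0.
  have ez : e = 0.
    apply/eqP; rewrite -sqrf_eq0 eq_le sqr_ge0 andbT.
    by rewrite -(pmulr_rle0 _ mn0); move: disc; rewrite p'z mul0r.
  rewrite p'z ez !(mulr0, mul0r) !add0r.
  exact: mulr_ge0 (mulr_ge0 (ltW n0) q'0) (sqr_ge0 _).
have p'1 : 0 < p' by rewrite lt_def p'nz.
rewrite -(pmulr_rge0 _ p'1).
rewrite [leRHS](_ : _ = m * (p' * w1 + n * e * w2) ^+ 2 +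
   n * w2 ^+ 2 * (p' * q' - m * n * e ^+ 2)); last by ring.
apply: addr_ge0; first exact: mulr_ge0 (ltW m0) (sqr_ge0 _).
apply: mulr_ge0; last by rewrite subr_ge0.
exact: mulr_ge0 (ltW n0) (sqr_ge0 _).
Qed.

(** [gap_pos] and [gap_neg] are the values at 1 and -1 of the characteristic
    polynomial X^2 - u X - al be E F, with
    u = al F - be E - D (al + be) (F - E), of the symmetric matrix S attached
    to the period map. *)
Definition gap_pos (R : realFieldType) (D al be E F : R) : R :=
  (1 - al * F) * (1 + be * E) + D * (al + be) * (F - E).
Definition gap_neg (R : realFieldType) (D al be E F : R) : R :=
  (1 + al * F) * (1 - be * E) - D * (al + be) * (F - E).

(** The Gram matrix of the period map, subtracted from that of the weighted form,
    has determinant [gap_pos * gap_neg] and trace at most 2. *)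
Lemma period_map_contracts (R : realFieldType) (D al be E F w1 w2 : R) :
  let G := D * (D - 1) in
  let gap := gap_pos D al be E F * gap_neg D al be E F in
  let w1' := (F - D * (F - E)) * al * w1 - G * (F - E) * be * w2 in
  let w2' := (F - E) * al * w1 + (E + D * (F - E)) * be * w2 in
  0 < al -> 0 < be -> 0 < E -> 0 < F -> 0 < G ->
  0 <= gap_pos D al be E F -> 0 <= gap_neg D al be E F ->
  al * w1' ^+ 2 + G * be * w2' ^+ 2 <=
  (1 - gap / 2) * (al * w1 ^+ 2 + G * be * w2 ^+ 2).
Proof.
move=> G gap w1' w2' al0 be0 E0 F0 G0 u0 l0.
pose x := (F - D * (F - E)) * al; pose z := (E + D * (F - E)) * be.
pose y2 := al * (G * be) * (F - E) ^+ 2.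
pose p := 1 - x ^+ 2 - y2; pose q := 1 - y2 - z ^+ 2.
pose e := (F - E) * (x - z).
have Gbe : 0 < G * be by apply: mulr_gt0.
have gapE : gap = p * q - al * (G * be) * e ^+ 2.
  by rewrite /gap /gap_pos /gap_neg /p /q /e /y2 /x /z /G; ring.
have gap0 : 0 <= gap by apply: mulr_ge0.
(* [- de] and [u] are the determinant and the trace of S. *)
pose de := al * be * E * F.
have de0 : 0 < de by rewrite !mulr_gt0.
pose u := al * F - be * E - D * (al + be) * (F - E).
have uE : gap_pos D al be E F = 1 - de - u by rewrite /gap_pos /de /u; ring.
have lE : gap_neg D al be E F = 1 - de + u by rewrite /gap_neg /de /u; ring.
have pqE : p + q = 2 - 2 * de - u ^+ 2.
  by rewrite /p /q /de /u /y2 /x /z /G; ring.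
have u2 : u ^+ 2 <= (1 - de) ^+ 2 by rewrite uE lE in u0 l0; nra.
have pq0 : 0 <= p + q.
  rewrite pqE; rewrite uE in u0; rewrite lE in l0.
  have d1 : de <= 1 by lra.
  nra.
have y20 : 0 <= al * (G * be) * e ^+ 2.
  by rewrite mulr_ge0 ?sqr_ge0 // mulr_ge0 ?ltW.
have pqge : 0 <= p * q by rewrite gapE in gap0; lra.
have p0 : 0 <= p by nra.
have q0 : 0 <= q by nra.
have pq2 : p + q <= 2 by rewrite pqE; have := sqr_ge0 u; lra.
rewrite gapE in gap0.
have := weighted_form_coercive w1 w2 al0 Gbe p0 q0 pq2 gap0.
rewrite -gapE => H.
rewrite -subr_ge0.
move: H; rewrite -subr_ge0; congr (0 <= _).
by rewrite /w1' /w2' /p /q /e /y2 /x /z /G; ring.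
Qed.

(** * Monotonicity of the gaps in the flee time *)

(** For D < 0, [gap_pos] decreases along the flee time.  This lemma and
    the next treat the two signs of p2: E grows with F, or E shrinks while F
    grows. *)
Lemma gap_pos_anti_expand (R : realFieldType) (D al be E F E0 F0 : R) :
  D < 0 -> 0 < be -> be < al -> E <= E0 -> F < F0 -> F - E <= F0 - E0 ->
  0 < E -> 0 < F ->
  gap_pos D al be E0 F0 < gap_pos D al be E F.
Proof.
move=> D0 be0 bal EE FF EF E_gt0 F_gt0; rewrite -subr_gt0.
have EFle : E * F <= E0 * F0 by apply: ler_pM; lra.
have -> : gap_pos D al be E F - gap_pos D al be E0 F0 =
  (al - be) * (F0 - F) + (be - D * (al + be)) * ((F0 - E0) - (F - E)) +
  al * be * (E0 * F0 - E * F) by rewrite /gap_pos; ring.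
have c1 : 0 < (al - be) * (F0 - F) by rewrite mulr_gt0 // subr_gt0.
have c2 : 0 <= (be - D * (al + be)) * ((F0 - E0) - (F - E)).
  by apply: mulr_ge0; [nra|rewrite subr_ge0].
have c3 : 0 <= al * be * (E0 * F0 - E * F).
  by rewrite mulr_ge0 ?subr_ge0 // mulr_ge0; lra.
lra.
Qed.

Lemma gap_pos_anti_saddle (R : realFieldType) (D al be E F E0 F0 : R) :
  D < 0 -> 0 < be -> be < al -> E0 <= E -> F < F0 -> 0 < E0 -> al * F <= 1 ->
  gap_pos D al be E0 F0 < gap_pos D al be E F.
Proof.
move=> D0 be0 bal EE FF E_gt0 aF; rewrite -subr_gt0.
have -> : gap_pos D al be E F - gap_pos D al be E0 F0 =
  (be * (1 - al * F) - D * (al + be)) * (E - E0) +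
  (al - D * (al + be) + al * be * E0) * (F0 - F) by rewrite /gap_pos; ring.
have D1 : 0 < - D * (al + be) by apply: mulr_gt0; lra.
have c1 : 0 <= be * (1 - al * F) by apply: mulr_ge0; lra.
have c2 : 0 < al * be * E0 by rewrite !mulr_gt0 //; lra.
have c3 : 0 < (al - D * (al + be) + al * be * E0) * (F0 - F).
  by apply: mulr_gt0; lra.
have c4 : 0 <= (be * (1 - al * F) - D * (al + be)) * (E - E0).
  by apply: mulr_ge0; lra.
lra.
Qed.

(** The term of [gap_pos] in D is at most 0 here, so that 1 - al F cannot be
    negative; this bound controls the other gap, and both factors of the quotient
    in [gap_pos_dwell]. *)
Lemma gap_pos_ge0_alF_le1 (R : realFieldType) (D al be E F : R) :
  D < 0 -> 0 < al -> 0 < be -> 0 < E -> E <= F -> 0 <= gap_pos D al be E F -> al * F <= 1.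
Proof.
move=> D0 al0 be0 E0 EF; rewrite /gap_pos => g0.
have c1 : 0 <= - D * (al + be) * (F - E) by rewrite !mulr_ge0; lra.
have c2 : 0 < be * E by apply: mulr_gt0.
nra.
Qed.

Lemma gap_neg_gt0_alF_le1 (R : realFieldType) (D al be E F : R) :
  D < 0 -> 0 < be -> be < al -> 0 < E -> E <= F -> al * F <= 1 ->
  0 < gap_neg D al be E F.
Proof.
move=> D0 be0 bal E0 EF aF; rewrite /gap_neg.
have c1 : 0 <= - D * (al + be) * (F - E) by rewrite !mulr_ge0; lra.
have c2 : be * E < 1 by nra.
have c3 : 0 < (1 + al * F) * (1 - be * E) by apply: mulr_gt0; nra.
lra.
Qed.

(** For D > 1 this form shows that al E <= 1 is enough for [gap_pos] to be
    nonnegative. *)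
Lemma gap_posE (R : realFieldType) (D al be E F : R) :
  gap_pos D al be E F =
  (1 - al * E) * (1 + be * F) + (D - 1) * (al + be) * (F - E).
Proof. by rewrite /gap_pos; ring. Qed.

(** For D > 1, the nonnegativity of [gap_neg] propagates to smaller flee times,
    for a different reason in each regime of p2.  If p2 >= 0, it is [gap_neg / E]
    that decreases. *)
Lemma gap_neg_expand (R : realFieldType) (D al be E F E0 F0 : R) :
  1 < D -> 0 < be -> 0 < al -> 0 < E -> E <= E0 -> F < F0 -> F * E0 <= F0 * E ->
  0 <= gap_neg D al be E0 F0 -> 0 < gap_neg D al be E F.
Proof.
move=> D1 be0 al0 E_gt0 EE FF FE g0.
have E0_gt0 : 0 < E0 by apply: lt_le_trans EE.
rewrite -(pmulr_lgt0 _ E0_gt0).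
have -> : gap_neg D al be E F * E0 = gap_neg D al be E0 F0 * E + (E0 - E) +
  al * be * E * E0 * (F0 - F) + (D * (al + be) - al) * (F0 * E - F * E0).
  by rewrite /gap_neg; ring.
have c1 : 0 < al * be * E * E0 * (F0 - F) by rewrite !mulr_gt0 // subr_gt0.
have c2 : 0 <= (D * (al + be) - al) * (F0 * E - F * E0).
  by apply: mulr_ge0; [nra|lra].
have c3 : 0 <= gap_neg D al be E0 F0 * E by rewrite mulr_ge0 // ltW.
lra.
Qed.

(** If p2 <= 0 <= p2 + q2, [gap_neg] itself decreases, because the determinant
    E F does not. *)
Lemma gap_neg_saddle (R : realFieldType) (D al be E F E0 F0 : R) :
  1 < D -> 0 < be -> 0 < al -> E0 <= E -> F < F0 -> E * F <= E0 * F0 ->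
  0 <= gap_neg D al be E0 F0 -> 0 < gap_neg D al be E F.
Proof.
move=> D1 be0 al0 EE FF FE g0.
have -> : gap_neg D al be E F = gap_neg D al be E0 F0 +
  (D * (al + be) - al) * (F0 - F) + (D * (al + be) - be) * (E - E0) +
  al * be * (E0 * F0 - E * F).
  by rewrite /gap_neg; ring.
have c1 : 0 < (D * (al + be) - al) * (F0 - F) by apply: mulr_gt0; [nra|lra].
have c2 : 0 <= (D * (al + be) - be) * (E - E0) by apply: mulr_ge0; [nra|lra].
have c3 : 0 <= al * be * (E0 * F0 - E * F).
  by rewrite mulr_ge0 ?subr_ge0 // mulr_ge0 // ltW.
lra.
Qed.

(** If p2 + q2 <= 0, it is [gap_neg / (F - E)] that decreases; the hypothesis on
    (1 - E F) / (F - E) absorbs the only term of the wrong sign. *)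
Lemma gap_neg_contract (R : realFieldType) (D al be E F E0 F0 : R) :
  0 < be -> be < al -> al < 1 -> 0 < F -> 0 < E0 -> E0 <= E -> F < F0 -> E <= F ->
  (F - E) * (1 - E0 * F0) <= (F0 - E0) * (1 - E * F) ->
  0 <= gap_neg D al be E0 F0 -> 0 < gap_neg D al be E F.
Proof.
move=> be0 bal al1 F_gt0 E0_gt0 EE FF EF key g0.
have FE0 : 0 < F0 - E0 by lra.
rewrite -(pmulr_lgt0 _ FE0).
pose K := (F0 - E0) - (F - E).
pose L := E * F * (F0 - E0) - E0 * F0 * (F - E).
have -> : gap_neg D al be E F * (F0 - E0) = gap_neg D al be E0 F0 * (F - E) +
  (al - be) * (F0 * E - F * E0) + (1 - al * be) * K + al * be * (K - L).
  by rewrite /gap_neg /K /L; ring.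
have K0 : 0 < K by rewrite /K; lra.
have LK : 0 <= K - L by rewrite /K /L; lra.
have c1 : 0 <= gap_neg D al be E0 F0 * (F - E) by rewrite mulr_ge0 // subr_ge0.
have c2 : 0 <= (al - be) * (F0 * E - F * E0).
  apply: mulr_ge0; first lra.
  by rewrite subr_ge0; apply: ler_pM; lra.
have c3 : 0 < (1 - al * be) * K by apply: mulr_gt0 => //; nra.
have c4 : 0 <= al * be * (K - L) by rewrite !mulr_ge0 //; lra.
lra.
Qed.

(** * Monotonicity of the gaps in the dwell time *)

(** As (1 + be E) / (al + be) = E + (1 - al E) / (al + be), the quotient
    (1 - al F) (1 + be E) / (al + be) is a product of two nonnegative functions
    that increase with the dwell time, as long as al F <= 1. *)
Lemma gap_pos_dwell (R : realFieldType) (D E F al1 be1 al2 be2 : R) :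
  D < 0 -> 0 < E -> E < F -> 0 < al2 -> 0 < be2 -> al2 < al1 -> be2 < be1 ->
  0 <= gap_pos D al1 be1 E F -> 0 < gap_pos D al2 be2 E F.
Proof.
move=> D0 E0 EF al0 be0 aa bb g1.
have al10 : 0 < al1 by lra.
have be10 : 0 < be1 by lra.
have aF := gap_pos_ge0_alF_le1 D0 al10 be10 E0 (ltW EF) g1.
have aE : al1 * E <= 1 by nra.
have S1 : 0 < al1 + be1 by lra.
rewrite -(pmulr_lgt0 _ S1).
have -> : gap_pos D al2 be2 E F * (al1 + be1) =
  gap_pos D al1 be1 E F * (al2 + be2) +
  (al1 - al2) * F * E * (al1 + be1) * (al2 + be2) +
  ((1 - al2 * F) * (1 - al2 * E) * (al1 + be1) -
   (1 - al1 * F) * (1 - al1 * E) * (al2 + be2)).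
  by rewrite /gap_pos; ring.
have c1 : 0 <= gap_pos D al1 be1 E F * (al2 + be2) by rewrite mulr_ge0 //; lra.
have c2 : 0 < (al1 - al2) * F * E * (al1 + be1) * (al2 + be2).
  by rewrite !mulr_gt0 //; lra.
suff : (1 - al1 * F) * (1 - al1 * E) * (al2 + be2) <=
       (1 - al2 * F) * (1 - al2 * E) * (al1 + be1) by lra.
have x1 : 0 <= (1 - al1 * F) by lra.
have x2 : 0 <= (1 - al1 * E) by lra.
by rewrite !ler_pM ?mulr_ge0 //; nra.
Qed.

(** After division by al, (1 + al F) (1 - be E) / (al + be) is the product of
    1 / al + F, of 1 - be E and of 1 / (1 + be / al), all increasing with the
    dwell time; the factor 1 - be E is positive as soon as the gap is
    nonnegative. *)
Lemma gap_neg_dwell (R : realFieldType) (D E F al1 be1 al2 be2 : R) :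
  1 < D -> 0 < E -> E < F -> 0 < al2 -> 0 < be2 -> al2 < al1 -> be2 < be1 ->
  al1 * be2 <= al2 * be1 ->
  0 <= gap_neg D al1 be1 E F -> 0 < gap_neg D al2 be2 E F.
Proof.
move=> D0 E0 EF al0 be0 aa bb ab g1.
have DS : 0 < D * (al1 + be1) * (F - E) by rewrite !mulr_gt0; lra.
have p1 : 0 < 1 + al1 * F by nra.
have bE : 0 < 1 - be1 * E.
  by rewrite -(pmulr_rgt0 _ p1); move: g1; rewrite /gap_neg; lra.
have S1 : 0 < al1 + be1 by lra.
rewrite -(pmulr_lgt0 _ S1).
have -> : gap_neg D al2 be2 E F * (al1 + be1) =
  gap_neg D al1 be1 E F * (al2 + be2) +
  (1 - be2 * E) * ((1 + al2 * F) * (al1 + be1)) -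
   (1 - be1 * E) * ((1 + al1 * F) * (al2 + be2)).
  by rewrite /gap_neg; ring.
have c1 : 0 <= gap_neg D al1 be1 E F * (al2 + be2) by rewrite mulr_ge0 //; lra.
suff : (1 - be1 * E) * ((1 + al1 * F) * (al2 + be2)) <
       (1 - be2 * E) * ((1 + al2 * F) * (al1 + be1)) by lra.
apply: ltr_pM; [lra| | |].
- by rewrite mulr_ge0 //; lra.
- by nra.
- rewrite -subr_gt0.
  have -> : (1 + al2 * F) * (al1 + be1) - (1 + al1 * F) * (al2 + be2) =
    (al1 - al2) + (be1 - be2) + F * (al2 * be1 - al1 * be2) by ring.
  have : 0 <= F * (al2 * be1 - al1 * be2) by rewrite mulr_ge0; lra.
  lra.
Qed.

(** * Flee times up to the bound *)

Lemma is_derive_expRM (R : realType) (a x : R) :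
  is_derive x 1 (fun s => expR (a * s)) (a * expR (a * x)).
Proof.
have h : is_derive x 1 (fun s : R => a * s) a.
  have := is_deriveZ a (is_derive_id x (1 : R)).
  by rewrite /GRing.scale /= mulr1.
have := is_derive1_comp (is_derive_expR (a * x)) h.
by rewrite mulrC.
Qed.

Lemma ler0_derive_le (R : realType) (f df : R -> R) (a b : R) :
  a <= b -> (forall x, a <= x <= b -> is_derive x 1 f (df x)) ->
  (forall x, a <= x <= b -> df x <= 0) -> f b <= f a.
Proof.
move=> ab fdf df0.
have [| |c cab e] := @MVT_segment R f df a b ab.
- by move=> x xab; apply: fdf; apply: subset_itv_oo_cc xab.
- apply: derivable_within_continuous => x; rewrite in_itv /= => xab.
  by case: (fdf x xab).
- move: cab; rewrite in_itv /= => cab; rewrite -subr_le0 e.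
  by rewrite mulr_le0_ge0 ?subr_ge0 // df0.
Qed.

(** sinh x / x is increasing. *)
Lemma sinh_ratio (R : realType) (p q s : R) : 0 <= q -> q <= p -> 0 <= s ->
  p * (expR (q * s) - expR (- q * s)) <= q * (expR (p * s) - expR (- p * s)).
Proof.
move=> q0 qp s0.
pose f u := p * (expR (q * u) - expR (- q * u)) - q * (expR (p * u) - expR (- p * u)).
pose df u := p * (q * expR (q * u) - - q * expR (- q * u)) -
   q * (p * expR (p * u) - - p * expR (- p * u)).
rewrite -subr_le0 -[leLHS]/(f s).
have -> : 0 = f 0 by rewrite /f !mulr0 expR0 !subrr !mulr0 subrr.
apply: (@ler0_derive_le _ f df 0 s s0) => u /andP[u0 _].
  have d a := is_derive_expRM a u.
  exact: is_deriveB (is_deriveZ p (is_deriveB (d q) (d (- q))))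
                    (is_deriveZ q (is_deriveB (d p) (d (- p)))).
have -> : df u = - (p * q * ((expR (p * u) + expR (- p * u)) -
                             (expR (q * u) + expR (- q * u)))).
  by rewrite /df; ring.
rewrite oppr_le0 !mulr_ge0 //; first exact: le_trans qp.
rewrite !mulNr !expRN.
have : 1 <= expR (q * u) by rewrite -expR0 ler_expR mulr_ge0.
have : expR (q * u) <= expR (p * u) by rewrite ler_expR ler_wpM2r.
move: (expR (q * u)) (expR (p * u)) => x y xy x1.
have xp : 0 < x by lra.
have yp : 0 < y by lra.
have -> : y + y^-1 - (x + x^-1) = (y - x) * (1 - (x * y)^-1).
  by field; rewrite !gt_eqF.
rewrite mulr_ge0 ?subr_ge0 // invf_le1 ?mulr_gt0 //.
nra.
Qed.

(** For p2 = - p the derivative of (1 - E F) / (F - E) has the sign of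
    p sinh (q2 u) - q2 sinh (p u). *)
Lemma saddle_growth_ratio (R : realType) (p2 q2 s eta : R) :
  0 < q2 -> p2 + q2 <= 0 -> 0 <= s <= eta ->
  (expR (q2 * s) - expR (p2 * s)) * (1 - expR (p2 * eta) * expR (q2 * eta)) <=
  (expR (q2 * eta) - expR (p2 * eta)) * (1 - expR (p2 * s) * expR (q2 * s)).
Proof.
move=> q20 pq /andP[s0 se].
pose E u := expR (p2 * u); pose F u := expR (q2 * u).
rewrite -/(E s) -/(E eta) -/(F s) -/(F eta).
have [->|sn0] := eqVneq s 0.
  by rewrite /E /F !mulr0 expR0 !subrr mul0r mulr1 subrr mulr0.
have sp : 0 < s by rewrite lt_def sn0.
have FE u : 0 < u -> 0 < F u - E u.
  by move=> u0; rewrite subr_gt0 ltr_expR ltr_pM2r //; lra.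
have dE (u : R) : is_derive u (1 : R) E (p2 * E u) by apply: is_derive_expRM.
have dF (u : R) : is_derive u (1 : R) F (q2 * F u) by apply: is_derive_expRM.
suff : (1 - E eta * F eta) / (F eta - E eta) <= (1 - E s * F s) / (F s - E s).
  rewrite ler_pdivrMr ?FE ?(lt_le_trans sp) // mulrAC ler_pdivlMr ?FE //.
  by rewrite mulrC [leRHS]mulrC.
pose f u := (1 - E u * F u) * (F u - E u)^-1.
pose df u := (1 - E u * F u) * (- (F u - E u) ^- 2 * (q2 * F u - p2 * E u)) +
  (F u - E u)^-1 * (0 - (E u * (q2 * F u) + F u * (p2 * E u))).
apply: (@ler0_derive_le _ f df s eta se) => u /andP[su _].
  have u0 : 0 < u by apply: lt_le_trans su.
  have nz : F u - E u != 0 by rewrite gt_eqF ?FE.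
  have dEF := is_deriveM (dE u) (dF u).
  have dnum : is_derive u (1 : R) (fun x => 1 - E x * F x)
      (0 - (E u * (q2 * F u) + F u * (p2 * E u))).
    exact: is_deriveB.
  have dden : is_derive u (1 : R) (fun x => F x - E x) (q2 * F u - p2 * E u).
    exact: is_deriveB.
  have dinv := @is_deriveV R (fun x => F x - E x) u _ _ nz dden.
  exact: (is_deriveM dnum dinv).
have u0 : 0 < u by apply: lt_le_trans su.
have Fu : 0 < F u by apply: expR_gt0.
have Eu : 0 < E u by apply: expR_gt0.
have -> : df u = - (E u * F u * (q2 * ((E u)^-1 - E u) - (- p2) * (F u - (F u)^-1))) /
   (F u - E u) ^+ 2.
  rewrite /df; field.
  by rewrite !gt_eqF ?FE.
rewrite mulNr oppr_le0 divr_ge0 ?sqr_ge0 //.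
apply: mulr_ge0; first by rewrite mulr_ge0 // ltW.
rewrite subr_ge0.
have := @sinh_ratio _ (- p2) q2 u (ltW q20) _ (ltW u0).
rewrite !opprK -!expRN -!mulNr; apply; lra.
Qed.

(** What a dwell time with al = e^(-p1 tau), be = e^(-q1 tau) must guarantee for
    every flee time up to [eta]: no expansion, and strict contraction below
    [eta]. *)
Definition flee_safe (R : realType) (D al be p2 q2 eta : R) : Prop :=
  forall s, 0 <= s <= eta ->
    [/\ 0 <= gap_pos D al be (expR (p2 * s)) (expR (q2 * s)),
        0 <= gap_neg D al be (expR (p2 * s)) (expR (q2 * s)) &
        s < eta -> 0 < gap_pos D al be (expR (p2 * s)) (expR (q2 * s)) *
                       gap_neg D al be (expR (p2 * s)) (expR (q2 * s))].

Lemma flee_safe_neg (R : realType) (D al be p2 q2 eta : R) :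
  D < 0 -> 0 < be -> be < al -> p2 < q2 -> 0 < q2 ->
  0 <= gap_pos D al be (expR (p2 * eta)) (expR (q2 * eta)) ->
  flee_safe D al be p2 q2 eta.
Proof.
move=> D0 be0 bal pq q0 g0 s /andP[s0 se].
have al0 : 0 < al by lra.
have EF u : 0 <= u -> expR (p2 * u) <= expR (q2 * u).
  by move=> u0; rewrite ler_expR ler_wpM2r // ltW.
have eta0 : 0 <= eta by apply: le_trans se.
have aF0 := gap_pos_ge0_alF_le1 D0 al0 be0 (expR_gt0 _) (EF _ eta0) g0.
have FF : expR (q2 * s) <= expR (q2 * eta) by rewrite ler_expR ler_pM2l.
have aF : al * expR (q2 * s) <= 1.
  by apply: le_trans aF0; rewrite ler_pM2l.
have gn : 0 < gap_neg D al be (expR (p2 * s)) (expR (q2 * s)).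
  by apply: gap_neg_gt0_alF_le1 => //; [exact: expR_gt0|exact: EF].
have gp : s < eta -> 0 < gap_pos D al be (expR (p2 * s)) (expR (q2 * s)).
  move=> slt; apply: le_lt_trans g0 _.
  have FF1 : expR (q2 * s) < expR (q2 * eta) by rewrite ltr_expR ltr_pM2l.
  have [p20|p20] := leP 0 p2.
    apply: gap_pos_anti_expand; rewrite ?expR_gt0 //.
    + by rewrite ler_expR ler_wpM2l.
    + have G u : expR (q2 * u) - expR (p2 * u) =
        expR (p2 * u) * (expR ((q2 - p2) * u) - 1).
        by rewrite mulrBr mulr1 -expRD -mulrDl addrCA subrr addr0.
      have h1 : 0 <= expR ((q2 - p2) * s) - 1.
        by rewrite subr_ge0 -expR0 ler_expR mulr_ge0 // subr_ge0 ltW.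
      have h2 : expR (p2 * s) <= expR (p2 * eta) by rewrite ler_expR ler_wpM2l.
      have h3 : expR ((q2 - p2) * s) - 1 <= expR ((q2 - p2) * eta) - 1.
        by rewrite lerB // ler_expR ler_wpM2l // subr_ge0 ltW.
      rewrite (G s) (G eta); exact: (ler_pM (expR_ge0 _) h1 h2 h3).
  apply: gap_pos_anti_saddle; rewrite ?expR_gt0 //.
  by rewrite ler_expR ler_wnM2l // ltW.
split; [|exact: ltW|by move=> /gp gp'; apply: mulr_gt0].
have [/gp/ltW//|ees] := ltP s eta.
by have -> : s = eta by apply/le_anti; rewrite se ees.
Qed.

Lemma flee_safe_pos (R : realType) (D al be p2 q2 eta : R) :
  1 < D -> 0 < be -> be < al -> al < 1 -> p2 < q2 -> 0 < q2 ->
  al * expR (p2 * eta) <= 1 ->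
  0 <= gap_neg D al be (expR (p2 * eta)) (expR (q2 * eta)) ->
  flee_safe D al be p2 q2 eta.
Proof.
move=> D0 be0 bal al1 pq q0 aE0 g0 s /andP[s0 se].
have al0 : 0 < al by lra.
have EF : expR (p2 * s) <= expR (q2 * s) by rewrite ler_expR ler_wpM2r // ltW.
have aEle : al * expR (p2 * s) <= 1.
  have [p20|p20] := leP 0 p2.
    by apply: le_trans aE0; rewrite ler_pM2l // ler_expR ler_wpM2l.
  have : expR (p2 * s) <= 1 by rewrite -expR0 ler_expR mulr_le0_ge0 // ltW.
  have := expR_gt0 (p2 * s); nra.
have aElt : s < eta -> al * expR (p2 * s) < 1.
  move=> slt; have [p20|p20] := ltP 0 p2.
    by apply: lt_le_trans aE0; rewrite ltr_pM2l // ltr_expR ltr_pM2l.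
  have : expR (p2 * s) <= 1 by rewrite -expR0 ler_expR mulr_le0_ge0.
  have := expR_gt0 (p2 * s); nra.
have c1 : 0 <= (D - 1) * (al + be) * (expR (q2 * s) - expR (p2 * s)).
  by rewrite !mulr_ge0 //; lra.
have c2 : 0 < 1 + be * expR (q2 * s).
  by have := mulr_gt0 be0 (expR_gt0 (q2 * s)); lra.
have gp : s < eta -> 0 < gap_pos D al be (expR (p2 * s)) (expR (q2 * s)).
  move=> /aElt aE1; rewrite gap_posE.
  have : 0 < (1 - al * expR (p2 * s)) * (1 + be * expR (q2 * s)).
    by apply: mulr_gt0 => //; lra.
  lra.
have gn : s < eta -> 0 < gap_neg D al be (expR (p2 * s)) (expR (q2 * s)).
  move=> slt.
  have FF : expR (q2 * s) < expR (q2 * eta) by rewrite ltr_expR ltr_pM2l.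
  have [p20|p20] := leP 0 p2.
    apply: gap_neg_expand g0; rewrite ?expR_gt0 //.
      by rewrite ler_expR ler_wpM2l.
    rewrite -!expRD ler_expR; nra.
  have EE : expR (p2 * eta) <= expR (p2 * s) by rewrite ler_expR ler_wnM2l // ltW.
  have [pq0|pq0] := leP 0 (p2 + q2).
    apply: gap_neg_saddle g0; rewrite ?expR_gt0 //.
    by rewrite -!expRD ler_expR -!mulrDl ler_wpM2l.
  apply: gap_neg_contract g0; rewrite ?expR_gt0 //.
  by apply: saddle_growth_ratio; rewrite ?s0 // ltW.
split; [|  |by move=> se1; rewrite mulr_gt0 ?gp ?gn].
  rewrite gap_posE.
  have : 0 <= (1 - al * expR (p2 * s)) * (1 + be * expR (q2 * s)).
    by apply: mulr_ge0; lra.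
  lra.
have [/gn/ltW//|ees] := ltP s eta.
by have -> : s = eta by apply/le_anti; rewrite se ees.
Qed.

(** * Existence and uniqueness of the thresholds *)

(** The crossing hypothesis, weaker than monotonicity, is all that the gaps
    satisfy as functions of the dwell time. *)
Lemma unique_crossing (R : realType) (g : R -> R) (T : R) :
  {within `[0, T], continuous g} -> 0 <= T -> g 0 < 0 -> 0 < g T ->
  (forall t1 t2, 0 < t1 -> t1 < t2 -> 0 <= g t1 -> 0 < g t2) ->
  exists tau, unique (fun t => 0 < t /\ g t = 0) tau.
Proof.
move=> gc T0 g0 gT cross.
have [|c] := IVT (v := 0) T0 gc.
  by rewrite ge_min le_max (ltW g0) (ltW gT) orbT.
rewrite in_itv /= => /andP[c0 _] gc0.
have c_gt0 : 0 < c.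
  rewrite lt_def c0 andbT; apply/eqP => cz.
  by move: g0; rewrite -cz gc0 cz ltxx.
exists c; split=> // t [t0 gt0].
have [ct|tc|//] := ltgtP c t.
- by have := cross _ _ c_gt0 ct; rewrite gc0 gt0 lexx ltxx => /(_ isT).
- by have := cross _ _ t0 tc; rewrite gc0 gt0 lexx ltxx => /(_ isT).
Qed.

Lemma continuous_expRM (R : realType) (a : R) : continuous (fun t => expR (a * t)).
Proof.
move=> t; apply: differentiable_continuous; apply/derivable1_diffP.
by case: (is_derive_expRM a t).
Qed.

(** Provides a time that is explicitly long enough for a gap to be positive. *)
Lemma expR_decay_small (R : realType) (p x : R) : 0 < p -> 0 <= x ->
  expR (- p * (x / p)) * (1 + x) <= 1.
Proof.
move=> p0 x0; have -> : - p * (x / p) = - x by field; rewrite gt_eqF.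
rewrite expRN mulrC ler_pdivrMr ?expR_gt0 // mul1r.
exact: expR_ge1Dx.
Qed.

Lemma threshold_pos (R : realType) (D p1 q1 E F : R) :
  0 < p1 -> p1 < q1 -> D < 0 -> 0 < E -> E < F -> 1 < F ->
  exists tau, unique
    (fun t => 0 < t /\ gap_pos D (expR (- p1 * t)) (expR (- q1 * t)) E F = 0) tau.
Proof.
move=> p0 pq D0 E0 EF F1.
(* Chosen so that al F - 2 D al (F - E) < 1 / 2 once al (1 + x) <= 1. *)
pose x := 2 * F - 4 * D * (F - E).
have x0 : 0 <= x by rewrite /x; nra.
pose T := x / p1.
have T0 : 0 <= T by rewrite divr_ge0 // ltW.
apply: (@unique_crossing R _ T) => //.
- apply: continuous_subspaceT => t.
  have ca := @continuous_expRM R (- p1) t.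
  have cb := @continuous_expRM R (- q1) t.
  apply: cvgD; last first.
    by apply: cvgMl; apply: cvgMr; exact: cvgD.
  apply: cvgM.
    by apply: cvgB; [exact: cvg_cst|exact: cvgMl].
  by apply: cvgD; [exact: cvg_cst|exact: cvgMl].
- rewrite /gap_pos !mulr0 expR0; nra.
- have := expR_decay_small p0 x0; rewrite -/T.
  have : expR (- q1 * T) <= expR (- p1 * T) by rewrite ler_expR; nra.
  have := expR_gt0 (- p1 * T); have := expR_gt0 (- q1 * T).
  rewrite /x /gap_pos; move: (expR _) (expR _) => al be be0 al0 ba h.
  have h1 : 0 <= (- D) * (F - E) * (al - be) by rewrite !mulr_ge0; lra.
  have h3 : 0 <= - D * (F - E) * al by rewrite !mulr_ge0; lra.
  have h4 : 0 < al * F by rewrite mulr_gt0 //; lra.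
  have h2 : 0 <= (1 - al * F) * (be * E).
    by rewrite mulr_ge0 ?(ltW (mulr_gt0 be0 E0)) //; lra.
  lra.
- move=> t1 t2 t10 t12; apply: gap_pos_dwell => //; try exact: expR_gt0.
    by rewrite ltr_expR ltr_nM2l // oppr_lt0.
  by rewrite ltr_expR ltr_nM2l // oppr_lt0 (lt_trans p0).
Qed.

Lemma gap_neg_dwell_expR (R : realType) (D p1 q1 E F t1 t2 : R) :
  0 < p1 -> p1 < q1 -> 1 < D -> 0 < E -> E < F -> t1 < t2 ->
  0 <= gap_neg D (expR (- p1 * t1)) (expR (- q1 * t1)) E F ->
  0 < gap_neg D (expR (- p1 * t2)) (expR (- q1 * t2)) E F.
Proof.
move=> p0 pq D1 E0 EF t12; apply: gap_neg_dwell => //; try exact: expR_gt0.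
- by rewrite ltr_expR ltr_nM2l // oppr_lt0.
- by rewrite ltr_expR ltr_nM2l // oppr_lt0 (lt_trans p0).
- rewrite -!expRD ler_expR; nra.
Qed.

Lemma threshold_neg (R : realType) (D p1 q1 E F : R) :
  0 < p1 -> p1 < q1 -> 1 < D -> 0 < E -> E < F -> 1 < F ->
  exists T, unique
    (fun t => 0 < t /\ gap_neg D (expR (- p1 * t)) (expR (- q1 * t)) E F = 0) T.
Proof.
move=> p0 pq D1 E0 EF F1.
(* Chosen so that al E + 2 D al (F - E) < 1 once al (1 + x) <= 1. *)
pose x := E + 2 * D * (F - E).
have x0 : 0 <= x by rewrite /x; nra.
pose T := x / p1.
have T0 : 0 <= T by rewrite divr_ge0 // ltW.
apply: (@unique_crossing R _ T) => //.
- apply: continuous_subspaceT => t.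
  have ca := @continuous_expRM R (- p1) t.
  have cb := @continuous_expRM R (- q1) t.
  apply: cvgB; last first.
    by apply: cvgMl; apply: cvgMr; exact: cvgD.
  apply: cvgM.
    by apply: cvgD; [exact: cvg_cst|exact: cvgMl].
  by apply: cvgB; [exact: cvg_cst|exact: cvgMl].
- rewrite /gap_neg !mulr0 expR0 !mul1r.
  have h : 0 < (D - 1) * 2 * (F - E) by rewrite !mulr_gt0 // subr_gt0.
  have h2 : 0 < (F - 1) * (1 + E) by rewrite mulr_gt0 //; lra.
  lra.
- have := expR_decay_small p0 x0; rewrite -/T.
  have : expR (- q1 * T) <= expR (- p1 * T) by rewrite ler_expR; nra.
  have := expR_gt0 (- p1 * T); have := expR_gt0 (- q1 * T).
  rewrite /x /gap_neg; move: (expR _) (expR _) => al be be0 al0 ba h.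
  have h1 : 0 <= D * (F - E) * (al - be) by rewrite !mulr_ge0; lra.
  have h2 : 0 <= al * (D * (F - E)) by rewrite !mulr_ge0; lra.
  have h3 : be * E <= al * E by rewrite ler_pM2r.
  have h4 : 0 <= al * F * (1 - be * E).
    by rewrite mulr_ge0 ?(ltW (mulr_gt0 al0 _)) //; lra.
  lra.
- move=> t1 t2 t10 t12; exact: gap_neg_dwell_expR.
Qed.

Lemma unique_iff (T : Type) (P Q : T -> Prop) x : (forall y, P y <-> Q y) ->
  unique P x -> unique Q x.
Proof.
by move=> PQ [Px Pu]; split=> [|y /PQ]; [exact/PQ|exact: Pu].
Qed.

(** The threshold equations say that a gap vanishes. *)
Lemma ratio_gap_pos (R : realFieldType) (D al be E F : R) :
  0 < al -> 0 < be -> E < F ->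
  (al * F - 1) * (1 + be * E) / ((al + be) * (F - E)) = D <->
  gap_pos D al be E F = 0.
Proof.
move=> al0 be0 EF.
have nz : (al + be) * (F - E) != 0 by rewrite mulf_neq0 // gt_eqF; lra.
split=> [<-|e]; first by rewrite /gap_pos; field; rewrite !gt_eqF; lra.
apply/(canLR (mulfK nz)); move: e; rewrite /gap_pos; lra.
Qed.

Lemma ratio_gap_neg (R : realFieldType) (D al be E F : R) :
  0 < al -> 0 < be -> E < F ->
  (1 + al * F) * (1 - be * E) / ((al + be) * (F - E)) = D <->
  gap_neg D al be E F = 0.
Proof.
move=> al0 be0 EF.
have nz : (al + be) * (F - E) != 0 by rewrite mulf_neq0 // gt_eqF; lra.
split=> [<-|e]; first by rewrite /gap_neg; field; rewrite !gt_eqF; lra.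
apply/(canLR (mulfK nz)); move: e; rewrite /gap_neg; lra.
Qed.

(** * Trajectories inside one mode *)

Lemma mulmx_col2E (R : realType) (Q : 'M[R]_2) (v : 'cV[R]_2) i :
  (Q *m v) i 0 = Q i 0 * v 0 0 + Q i 1 * v 1 0.
Proof.
rewrite mxE !big_ord_recl big_ord0 addr0.
by congr (_ + Q i _ * v _ _); apply/val_inj.
Qed.

Lemma mul_diag2_col (R : realType) (u v : R) (w : 'cV[R]_2) :
  ((diag2 u v *m w) 0 0 = u * w 0 0) * ((diag2 u v *m w) 1 0 = v * w 1 0).
Proof. by split; rewrite mulmx_col2E !mxE /= !mulr1n !mulr0n mul0r ?addr0 ?add0r. Qed.

Lemma enorm_sq (R : realType) (v : 'cV[R]_2) :
  enorm v ^+ 2 = v 0 0 ^+ 2 + v 1 0 ^+ 2.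
Proof.
rewrite sqr_sqrtr; last by apply: sumr_ge0 => i _; apply: sqr_ge0.
rewrite !big_ord_recl big_ord0 addr0.
by congr (_ + v _ _ ^+ 2); apply/val_inj.
Qed.

(** e^(- l t) z(t) has zero derivative inside the interval, and continuity up to
    the end points carries the formula across switching times. *)
Lemma exp_flow (R : realType) (z : R -> R) (l a b : R) :
  {within `[a, b], continuous z} ->
  (forall t, a < t < b -> is_derive t 1 z (l * z t)) ->
  forall t, a <= t <= b -> z t = expR (l * (t - a)) * z a.
Proof.
move=> zc zd t /andP[at_ tb].
pose f u := expR (- l * u) * z u.
have [| |c _] := @MVT_segment R f (fun=> 0) a t at_.
- move=> u; rewrite in_itv /= => /andP[au ut].
  have uab : a < u < b by rewrite au (lt_le_trans ut).
  have := is_deriveM (is_derive_expRM (- l) u) (zd u uab).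
  have -> : expR (- l * u) *: (l * z u) + z u *: (- l * expR (- l * u)) = 0 :> R.
    by rewrite /GRing.scale /=; ring.
  by [].
- have zc' : {within `[a, t], continuous z}.
    by apply: continuous_subspaceW zc; apply: subset_itvl; rewrite bnd_simp.
  move=> u; apply: cvgM; last exact: zc'.
  by apply: continuous_subspaceT; apply: continuous_expRM.
rewrite mul0r => /eqP; rewrite subr_eq0 => /eqP; rewrite /f => e.
have -> : l * (t - a) = l * t + - l * a by ring.
rewrite expRD -mulrA -e mulrA -expRD.
by rewrite mulNr subrr expR0 mul1r.
Qed.

Lemma is_derive_entry (R : realType) (x : R -> 'cV[R]_2) (t : R) (dx : 'cV[R]_2) i :
  is_derive t 1 x dx -> is_derive t 1 (fun u => x u i 0) (dx i 0).
Proof.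
move=> [xd <-]; split; first by move/derivable_mxP : xd; apply.
by rewrite derive_mx // mxE.
Qed.

Lemma mode_flow (R : realType) (x : R -> 'cV[R]_2) (P : 'M[R]_2) (u v a b : R) :
  P \in unitmx -> {within `[a, b], continuous x} ->
  (forall t, a < t < b ->
     is_derive t 1 x ((P *m diag2 u v *m invmx P) *m x t)) ->
  forall t, a <= t <= b ->
    invmx P *m x t =
    diag2 (expR (u * (t - a))) (expR (v * (t - a))) *m (invmx P *m x a).
Proof.
move=> Pu xc xd t tab.
pose y i s := (invmx P *m x s) i 0.
have yE i : y i = fun s => invmx P i 0 * x s 0 0 + invmx P i 1 * x s 1 0.
  by apply/funext => s; rewrite /y mulmx_col2E.
have yc i : {within `[a, b], continuous (y i)}.
  rewrite yE => s; have xs := xc s.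
  have c j : (fun r : subspace `[a, b] => x r j 0) r @[r --> s] --> x s j 0.
    apply: (@cvg_comp _ _ _ x (fun M : 'cV[R]_2 => M j 0)); first exact: xs.
    exact: coord_continuous.
  by apply: cvgD; apply: cvgMr; exact: c.
have yd i s : a < s < b -> is_derive s 1 (y i) ((if i == 0 then u else v) * y i s).
  move=> sab; have d j := is_derive_entry j (xd s sab).
  have := is_deriveD (is_deriveZ (invmx P i 0) (d 0)) (is_deriveZ (invmx P i 1) (d 1)).
  rewrite -mulmx_col2E !mulmxA mulVmx // mul1mx -mulmxA.
  have -> : (diag2 u v *m (invmx P *m x s)) i 0 = (if i == 0 then u else v) * y i s.
    case: (eqVneq i 0) => [->|i0]; first by rewrite mul_diag2_col.
    have -> : i = 1 by apply/val_inj; move: i i0 => [[|[|//]]//].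
    by rewrite mul_diag2_col.
  by rewrite yE.
have sol i := exp_flow (yc i) (yd i) tab.
apply/matrixP => i j; rewrite ord1 {j}.
case: (eqVneq i 0) => [->|i0]; first by rewrite mul_diag2_col; exact: (sol 0).
have -> : i = 1 by apply/val_inj; move: i i0 => [[|[|//]]//].
by rewrite mul_diag2_col; exact: (sol 1).
Qed.

(** * Switching signals and Lyapunov functions *)

Lemma switching_times_homo (R : realType) (sigma : R -> mode) d :
  switching_times sigma d -> {homo d : i j / (i <= j)%N >-> i <= j}.
Proof.
by move=> [_ dlt _ _ _]; apply/nondecreasing_seqP => k; apply/ltW/dlt.
Qed.

Lemma switching_times_ge0 (R : realType) (sigma : R -> mode) d k :
  switching_times sigma d -> 0 <= d k.
Proof.
by move=> sw; have [d0 _ _ _ _] := sw; rewrite -[leLHS]d0 (switching_times_homo sw).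
Qed.

Lemma switching_modes (R : realType) (sigma : R -> mode) d :
  switching_times sigma d -> sigma 0 = mode1 ->
  forall k, sigma (d k) = if odd k then mode2 else mode1.
Proof.
move=> [d0 _ _ _ alt] s0; elim=> [|k IH] /=; first by rewrite d0.
have := alt k; rewrite IH.
by case: (odd k); case: (sigma (d k.+1)).
Qed.

Lemma solution_derive (R : realType) (A : mode -> 'M[R]_2) (sigma : R -> mode) d x k t :
  switching_times sigma d -> solution A sigma x -> d k < t < d k.+1 ->
  is_derive t 1 x (A (sigma (d k)) *m x t).
Proof.
move=> sw [_ xd] /andP[dt td]; have [_ _ _ const _] := sw.
have st u : d k < u < d k.+1 -> sigma u = sigma (d k).
  by move=> /andP[du ud]; apply: const; rewrite ltW.
rewrite -(st t) ?dt //; apply: xd; first exact: le_lt_trans (switching_times_ge0 k sw) dt.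
have tk : t \in `]d k, d k.+1[ by rewrite in_itv /= dt.
near=> u.
have : u \in `]d k, d k.+1[ by near: u; exact: near_in_itvoo.
by rewrite in_itv /= => uk; rewrite (st u uk) st // dt.
Unshelve. all: by end_near. Qed.

Lemma solution_within (R : realType) (A : mode -> 'M[R]_2) (sigma : R -> mode) d x k :
  switching_times sigma d -> solution A sigma x ->
  {within `[d k, d k.+1], continuous x}.
Proof.
move=> sw [xc _]; apply: continuous_subspaceW xc => t /=.
by rewrite !in_itv /= andbT => /andP[+ _]; apply: le_trans (switching_times_ge0 k sw).
Qed.

Lemma not_cvg_pair_infinitely_often (R : realType) (u v : nat -> R) (a b : R) :
  (forall k, a <= u k) -> (forall k, v k <= b) ->
  ~ ((u k, v k) @[k --> \oo] --> (a, b)) ->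
  exists2 e, 0 < e &
    forall N, exists2 k, (N <= k)%N & a + e <= u k \/ v k <= b - e.
Proof.
move=> au vb; apply: contra_notP => /forall2NP h.
have near_lim e : 0 < e -> exists N, forall k, (N <= k)%N -> u k < a + e /\ b - e < v k.
  move=> e0; have [//|/existsNP[N hN]] := h e; exists N => k Nk.
  have /forall2NP/(_ k)[//|/not_orP[/negP + /negP]] := hN.
  by rewrite -!ltNge.
have cu : u k @[k --> \oo] --> a.
  apply/cvgrPdist_lt => e /near_lim[N hN]; exists N => // k /= /hN[h1 _].
  by rewrite distrC ger0_norm ?subr_ge0 // ltrBlDl.
have cv : v k @[k --> \oo] --> b.
  apply/cvgrPdist_lt => e /near_lim[N hN]; exists N => // k /= /hN[_ h2].
  by rewrite ger0_norm ?subr_ge0 // ltrBlDr -ltrBlDl.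
exact: cvg_pair cu cv.
Qed.

Lemma infinitely_often_contracting_cvg0 (R : realType) (v : nat -> R) (c : R) :
  0 <= c -> c < 1 -> (forall k, 0 <= v k) -> (forall k, v k.+1 <= v k) ->
  (forall N, exists2 k, (N <= k)%N & v k.+1 <= c * v k) ->
  forall e, 0 < e -> exists k, v k < e.
Proof.
move=> c0 c1 v0 vdec vc e e0.
have vhomo : {homo v : i j / (i <= j)%N >-> j <= i} by apply/nonincreasing_seqP.
have pow n : exists k, v k <= c ^+ n * v 0%N.
  elim: n => [|n [k IH]]; first by exists 0%N; rewrite mul1r.
  have [j kj vj] := vc k; exists j.+1; apply: le_trans vj _.
  by rewrite exprS -mulrA ler_wpM2l // (le_trans (vhomo _ _ kj)).
have cn : c ^+ n @[n --> \oo] --> 0 by apply: cvg_expr; rewrite ger0_norm.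
have v1 : 0 < v 0%N + 1 by rewrite ltr_wpDl.
have /cvgrPdist_lt/(_ (e / (v 0%N + 1)) (divr_gt0 e0 v1))[N _ /(_ N (leqnn N))] := cn.
rewrite /= sub0r normrN ger0_norm ?exprn_ge0 // ltr_pdivlMr // => cN.
have [k vk] := pow N; exists k; apply: le_lt_trans vk _.
by apply: le_lt_trans cN; rewrite ler_wpM2l ?exprn_ge0 // lerDl.
Qed.

(** A quadratic Lyapunov function observed at the beginning of each period
    suffices.  The factor [c] must depend on [e] only: the periods that are long
    in mode 1 or short in mode 2 by [e] occur infinitely often, at unknown
    indices. *)
Lemma periodwise_lyapunov (R : realType) (A : mode -> 'M[R]_2) (tau eta : R)
    (V : 'cV[R]_2 -> R) (m M : R) :
  0 < m -> 0 < M ->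
  (forall v, enorm v ^+ 2 <= M * V v) -> (forall v, V v <= m * enorm v ^+ 2) ->
  (forall sigma d x k t, admissible tau eta sigma d -> solution A sigma x ->
     d k.*2 <= t <= d k.*2.+2 -> V (x t) <= V (x (d k.*2))) ->
  (forall e, 0 < e -> exists2 c, 0 <= c < 1 &
     forall sigma d x k, admissible tau eta sigma d -> solution A sigma x ->
     tau + e <= dwell d k \/ flee d k <= eta - e ->
     V (x (d k.*2.+2)) <= c * V (x (d k.*2))) ->
  stable_from A tau eta.
Proof.
move=> m0 M0 VM Vm Vdec Vcontr.
have V0 v : 0 <= V v.
  by rewrite -(pmulr_rge0 _ M0); apply: le_trans (VM v); apply: sqr_ge0.
have Vtail sigma d x k t : admissible tau eta sigma d -> solution A sigma x ->
    d k.*2 <= t -> V (x t) <= V (x (d k.*2)).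
  move=> adm sol; have [sw _ _ _] := adm; have [_ _ doo _ _] := sw.
  have /cvgryPge/(_ t)[N _ /(_ N (leqnn N)) /= tN] := doo.
  have {tN} : t <= d (k + N)%N.*2.
    apply: le_trans tN (switching_times_homo sw _).
    by rewrite (leq_trans (leq_addl k N)) // -addnn leq_addr.
  elim: N k => [|N IH] k tN kt.
    by move: tN; rewrite addn0 => tk; rewrite (@le_anti _ _ t (d k.*2)) ?tk.
  have [tk|kt'] := leP t (d k.*2.+2); first by apply: Vdec adm sol _; rewrite kt.
  apply: le_trans (IH k.+1 _ (ltW kt')) _; first by rewrite addSnnS.
  apply: Vdec adm sol _; rewrite lexx andbT.
  by apply: (switching_times_homo sw); rewrite ltnW.
have Vinit sigma d x t : admissible tau eta sigma d -> solution A sigma x ->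
    0 <= t -> V (x t) <= V (x 0).
  move=> adm sol t0; have [[d0 _ _ _ _] _ _ _] := adm.
  by have := Vtail _ _ _ 0%N t adm sol; rewrite /= d0; apply.
have stab sigma : signals tau eta sigma -> stable A sigma.
  move=> [d adm] eps eps0; pose K := M * m.
  have K0 : 0 < K by apply: mulr_gt0.
  have K1 : 0 < 1 + K by rewrite addr_gt0.
  exists (eps / (1 + K)); first exact: divr_gt0.
  move=> x sol x0 t t0.
  rewrite -(ltr_pXn2r (n := 2)) ?nnegrE ?sqrtr_ge0 ?ltW //.
  apply: le_lt_trans (VM _) _.
  have : M * V (x t) <= M * V (x 0) by rewrite ler_pM2l // (Vinit _ _ _ _ adm sol) // ltW.
  move=> /le_lt_trans; apply.
  apply: (@le_lt_trans _ _ (K * enorm (x 0) ^+ 2)).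
    by rewrite /K -mulrA ler_pM2l.
  move: x0; rewrite ltr_pdivlMr // => x0.
  have e0 : 0 <= enorm (x 0) by apply: sqrtr_ge0.
  have : (enorm (x 0) * (1 + K)) ^+ 2 < eps ^+ 2.
    by rewrite ltr_pXn2r // ?nnegrE ?mulr_ge0 // ltW.
  apply: le_lt_trans; rewrite exprMn mulrC ler_wpM2l ?sqr_ge0 //.
  nra.
split=> // sigma [d adm nc]; split; first by apply: stab; exists d.
move=> x sol; have [sw _ dw fl] := adm.
have [e e0 often] := not_cvg_pair_infinitely_often dw fl nc.
have [c /andP[c0 c1] contr] := Vcontr e e0.
apply/cvgrPdist_lt => eps eps0.
have [] := @infinitely_often_contracting_cvg0 R (fun k => V (x (d k.*2))) c c0 c1 _ _ _
  (eps ^+ 2 / M) (divr_gt0 (exprn_gt0 2 eps0) M0).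
- by move=> k; apply: V0.
- move=> k; apply: Vtail adm sol _.
  by apply: (switching_times_homo sw); rewrite leq_double.
- move=> N; have [k Nk hk] := often N; exists k => //.
  exact: contr adm sol hk.
move=> k; rewrite ltr_pdivlMr // => Vk.
exists (d k.*2); split; first exact: num_real.
move=> t /ltW kt; rewrite sub0r normrN ger0_norm ?sqrtr_ge0 //.
rewrite -(ltr_pXn2r (n := 2)) ?nnegrE ?sqrtr_ge0 ?ltW //.
apply: le_lt_trans (VM _) (le_lt_trans _ Vk).
by rewrite mulrC ler_pM2r // (Vtail _ _ _ _ _ adm sol).
Qed.

(** * The quadratic Lyapunov function of the switched system *)

(** A quadratic form diagonal in the eigencoordinates of mode 1, hence
    nonincreasing along that mode. *)
Definition weighted_sq (R : realType) (P : 'M[R]_2) (l1 l2 : R) (v : 'cV[R]_2) : R :=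
  l1 * (invmx P *m v) 0 0 ^+ 2 + l2 * (invmx P *m v) 1 0 ^+ 2.

Lemma enorm_mulmx_le (R : realType) (Q : 'M[R]_2) :
  exists2 C, 0 < C & forall v, enorm (Q *m v) ^+ 2 <= C * enorm v ^+ 2.
Proof.
pose r i := Q i 0 ^+ 2 + Q i 1 ^+ 2.
have r0 i : 0 <= r i by rewrite addr_ge0 ?sqr_ge0.
exists (1 + (r 0 + r 1)); first by have := r0 0; have := r0 1; lra.
move=> v; rewrite !enorm_sq !mulmx_col2E.
have CS (a b x y : R) : (a * x + b * y) ^+ 2 <= (a ^+ 2 + b ^+ 2) * (x ^+ 2 + y ^+ 2).
  rewrite -subr_ge0 (_ : _ - _ = (a * y - b * x) ^+ 2) ?sqr_ge0 //.
  by ring.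
have h0 := CS (Q 0 0) (Q 0 1) (v 0 0) (v 1 0).
have h1 := CS (Q 1 0) (Q 1 1) (v 0 0) (v 1 0).
have n0 : 0 <= v 0 0 ^+ 2 + v 1 0 ^+ 2 by rewrite addr_ge0 ?sqr_ge0.
rewrite /r; lra.
Qed.

Lemma weighted_sq_equiv (R : realType) (P : 'M[R]_2) (l1 l2 : R) :
  P \in unitmx -> 0 < l1 -> 0 < l2 ->
  exists m M, [/\ 0 < m, 0 < M,
    forall v, enorm v ^+ 2 <= M * weighted_sq P l1 l2 v &
    forall v, weighted_sq P l1 l2 v <= m * enorm v ^+ 2].
Proof.
move=> Pu l10 l20.
have [C C0 hC] := enorm_mulmx_le P; have [C' C'0 hC'] := enorm_mulmx_le (invmx P).
exists ((l1 + l2) * C'), (C * (l1^-1 + l2^-1)); split.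
- by rewrite mulr_gt0 // addr_gt0.
- by rewrite mulr_gt0 // addr_gt0 ?invr_gt0.
- move=> v; have := hC (invmx P *m v); rewrite mulKVmx // => h.
  apply: le_trans h _; rewrite -mulrA ler_pM2l // enorm_sq /weighted_sq.
  move: (_ 0 0) (_ 1 0) => y1 y2.
  have -> : (l1^-1 + l2^-1) * (l1 * y1 ^+ 2 + l2 * y2 ^+ 2) =
    y1 ^+ 2 + y2 ^+ 2 + (l2^-1 * l1 * y1 ^+ 2 + l1^-1 * l2 * y2 ^+ 2).
    by field; rewrite !gt_eqF.
  rewrite lerDl addr_ge0 // mulr_ge0 ?sqr_ge0 // mulr_ge0 ?invr_ge0 //; exact: ltW.
- move=> v; apply: (@le_trans _ _ ((l1 + l2) * enorm (invmx P *m v) ^+ 2)).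
    rewrite enorm_sq /weighted_sq; move: (_ 0 0) (_ 1 0) => y1 y2.
    have := mulr_ge0 (ltW l10) (sqr_ge0 y2); have := mulr_ge0 (ltW l20) (sqr_ge0 y1).
    lra.
  by rewrite -mulrA ler_pM2l // addr_gt0.
Qed.

Lemma dwell_phase (R : realType) (A2 P1 : 'M[R]_2) (p1 q1 tau eta : R) sigma d x k t :
  P1 \in unitmx -> admissible tau eta sigma d ->
  solution (subsystem (P1 *m diag2 (- p1) (- q1) *m invmx P1) A2) sigma x ->
  d k.*2 <= t <= d k.*2.+1 ->
  invmx P1 *m x t = diag2 (expR (- p1 * (t - d k.*2))) (expR (- q1 * (t - d k.*2)))
    *m (invmx P1 *m x (d k.*2)).
Proof.
move=> Pu [sw s0 _ _] sol; apply: mode_flow => //; first exact: solution_within sw sol.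
move=> u uk; have := solution_derive sw sol uk.
by rewrite (switching_modes sw s0) odd_double.
Qed.

Lemma flee_phase (R : realType) (A1 P2 : 'M[R]_2) (p2 q2 tau eta : R) sigma d x k t :
  P2 \in unitmx -> admissible tau eta sigma d ->
  solution (subsystem A1 (P2 *m diag2 p2 q2 *m invmx P2)) sigma x ->
  d k.*2.+1 <= t <= d k.*2.+2 ->
  invmx P2 *m x t = diag2 (expR (p2 * (t - d k.*2.+1))) (expR (q2 * (t - d k.*2.+1)))
    *m (invmx P2 *m x (d k.*2.+1)).
Proof.
move=> Pu [sw s0 _ _] sol; apply: mode_flow => //; first exact: solution_within sw sol.
move=> u uk; have := solution_derive sw sol uk.
by rewrite (switching_modes sw s0) /= odd_double.
Qed.

Lemma det2E (R : comNzRingType) (M : 'M[R]_2) :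
  \det M = M 0 0 * M 1 1 - M 0 1 * M 1 0.
Proof.
rewrite (expand_det_row _ 0) !big_ord_recl big_ord0 addr0 /cofactor !det_mx11 !mxE.
rewrite /= expr0 expr1 mul1r mulN1r mulrN.
by congr (M _ _ * M _ _ - M _ _ * M _ _); apply/val_inj.
Qed.

(** The matrix M^-1 diag (E, F) M, in the case of determinant 1. *)
Lemma flee_map_coords (R : realType) (M : 'M[R]_2) (E F : R) (y z : 'cV[R]_2) :
  \det M = 1 -> M *m z = diag2 E F *m (M *m y) ->
  let D := M 0 0 * M 1 1 in
  (z 0 0 = (F - D * (F - E)) * y 0 0 - M 0 1 * M 1 1 * (F - E) * y 1 0) /\
  (z 1 0 = M 0 0 * M 1 0 * (F - E) * y 0 0 + (E + D * (F - E)) * y 1 0).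
Proof.
move=> + e D; rewrite det2E => det1.
have e0 : (M *m z) 0 0 = E * (M *m y) 0 0 by rewrite e mul_diag2_col.
have e1 : (M *m z) 1 0 = F * (M *m y) 1 0 by rewrite e mul_diag2_col.
move: e0 e1 det1; rewrite !mulmx_col2E /D.
move: (M 0 0) (M 0 1) (M 1 0) (M 1 1) (z 0 0) (z 1 0) (y 0 0) (y 1 0).
move=> a b c dd z0 z1 y0 y1 e0 e1 det1; split.
  have -> : z0 = dd * (a * z0 + b * z1) - b * (c * z0 + dd * z1).
    by rewrite -[LHS]mul1r -det1; ring.
  rewrite e0 e1.
  have -> : b * (F * (c * y0 + dd * y1)) =
    F * (a * dd - (a * dd - b * c)) * y0 + F * b * dd * y1 by ring.
  by rewrite det1; ring.
have -> : z1 = a * (c * z0 + dd * z1) - c * (a * z0 + b * z1).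
  by rewrite -[LHS]mul1r -det1; ring.
rewrite e0 e1.
have -> : c * (E * (a * y0 + b * y1)) =
  E * a * c * y0 + E * (a * dd - (a * dd - b * c)) * y1 by ring.
by rewrite det1; ring.
Qed.

(** The surplus of dwell time over the threshold contracts the weighted form at
    the rate of the slower eigenvalue. *)
Lemma weighted_decay (R : realFieldType) (l1 l2 r1 r2 y1 y2 : R) :
  0 <= l1 -> 0 <= l2 -> 0 <= r2 -> r2 <= r1 ->
  l1 * (r1 * y1) ^+ 2 + l2 * (r2 * y2) ^+ 2 <= r1 ^+ 2 * (l1 * y1 ^+ 2 + l2 * y2 ^+ 2).
Proof.
move=> l10 l20 r20 r21.
have h : r2 ^+ 2 <= r1 ^+ 2 by rewrite ler_sqr ?nnegrE // (le_trans r20).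
have := mulr_ge0 (mulr_ge0 l20 (sqr_ge0 y2)); move=> /(_ (r1 ^+ 2 - r2 ^+ 2)).
rewrite subr_ge0 => /(_ h); lra.
Qed.

(** The surplus dwell - tau acts first as a contraction of mode 1, and what
    remains of the period is the map of [period_map_contracts] with a flee time
    at most [eta].  For flee times at most eta - e, the product of the gaps is
    bounded below by compactness. *)
Lemma stable_from_flee_safe (R : realType) (p1 q1 p2 q2 : R) (P1 P2 : 'M[R]_2)
    (tau eta : R) :
  let M := invmx P2 *m P1 in
  let D := M 0 0 * M 1 1 in
  0 < p1 -> p1 < q1 -> 0 < eta -> P1 \in unitmx -> P2 \in unitmx ->
  \det M = 1 -> M 0 0 * M 1 0 != 0 -> 0 < D * (D - 1) ->
  flee_safe D (expR (- p1 * tau)) (expR (- q1 * tau)) p2 q2 eta ->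
  stable_from (subsystem (P1 *m diag2 (- p1) (- q1) *m invmx P1)
                         (P2 *m diag2 p2 q2 *m invmx P2)) tau eta.
Proof.
move=> M D p0 pq eta0 P1u P2u det1 h0 G0 safe.
pose h := M 0 0 * M 1 0; pose G := D * (D - 1).
pose al := expR (- p1 * tau); pose be := expR (- q1 * tau).
have al0 : 0 < al by apply: expR_gt0.
have be0 : 0 < be by apply: expR_gt0.
have Gbe : 0 < G * be by apply: mulr_gt0.
have l1 : 0 < al * h ^+ 2 by rewrite mulr_gt0 // lt_def sqr_ge0 sqrf_eq0 h0.
pose V := weighted_sq P1 (al * h ^+ 2) (G * be).
pose gap s := gap_pos D al be (expR (p2 * s)) (expR (q2 * s)) *
              gap_neg D al be (expR (p2 * s)) (expR (q2 * s)).
have V0 v : 0 <= V v by rewrite addr_ge0 // mulr_ge0 ?sqr_ge0 // ltW.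
(* Scaling the first coordinate by [h] turns the off-diagonal entries
   - bd (F - E) and ac (F - E) into - G (F - E) and F - E. *)
have hbd : h * (M 0 1 * M 1 1) = G.
  move: det1; rewrite det2E => /eqP; rewrite subr_eq => /eqP bc.
  rewrite /h /G /D.
  have -> : M 0 0 * M 1 1 * (M 0 0 * M 1 1 - 1) = M 0 0 * M 1 1 * (M 0 1 * M 1 0).
    by rewrite bc; ring.
  by ring.
pose A := subsystem (P1 *m diag2 (- p1) (- q1) *m invmx P1)
                    (P2 *m diag2 p2 q2 *m invmx P2).
have dwell_dec sigma d x k t : admissible tau eta sigma d -> solution A sigma x ->
    d k.*2 <= t <= d k.*2.+1 -> V (x t) <= V (x (d k.*2)).
  move=> adm sol tk; rewrite /V /weighted_sq (dwell_phase P1u adm sol tk) !mul_diag2_col.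
  have r0 : 0 <= t - d k.*2 by case/andP: tk; rewrite subr_ge0.
  apply: le_trans (weighted_decay _ _ (ltW l1) (ltW Gbe) (expR_ge0 _) _) _.
    rewrite ler_expR ler_wpM2r // lerN2; exact: ltW.
  rewrite -[leRHS]mul1r ler_wpM2r ?V0 //.
  by rewrite expr_le1 ?expR_ge0 // -expR0 ler_expR mulNr oppr_le0 mulr_ge0 // ltW.
(* [W] is the value of the form after the surplus of dwell time alone. *)
have flee_dec sigma d x k t : admissible tau eta sigma d -> solution A sigma x ->
    d k.*2.+1 <= t <= d k.*2.+2 ->
    exists W, [/\ 0 <= W,
      W <= expR (- p1 * (dwell d k - tau)) ^+ 2 * V (x (d k.*2)) &
      V (x t) <= (1 - gap (t - d k.*2.+1) / 2) * W].
  move=> adm sol tk; have [sw _ dw fl] := adm.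
  have [_ dlt _ _ _] := sw.
  have dd : d k.*2 <= d k.*2.+1 <= d k.*2.+1 by rewrite lexx ltW.
  have e1 := dwell_phase P1u adm sol dd; rewrite -/(dwell d k) in e1.
  have e2 := flee_phase P2u adm sol tk.
  set s := t - d k.*2.+1 in e2 *.
  have sle : 0 <= s <= eta.
    case/andP: tk => tk1 tk2; rewrite subr_ge0 tk1 /=.
    by apply: le_trans (fl k); rewrite lerB.
  have PM v : invmx P2 *m v = M *m (invmx P1 *m v) by rewrite /M mulmxA mulmxK.
  rewrite !PM in e2.
  have [] := flee_map_coords det1 e2.
  rewrite e1 !mul_diag2_col -/D.
  set y1 := (invmx P1 *m x (d k.*2)) 0 0; set y2 := (invmx P1 *m x (d k.*2)) 1 0.
  set r1 := expR (- p1 * (dwell d k - tau)); pose r2 := expR (- q1 * (dwell d k - tau)).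
  have -> : expR (- p1 * dwell d k) = al * r1.
    by rewrite -expRD -mulrDr; congr (expR (_ * _)); ring.
  have -> : expR (- q1 * dwell d k) = be * r2.
    by rewrite -expRD -mulrDr; congr (expR (_ * _)); ring.
  move=> z1 z2.
  exists (al * (h * (r1 * y1)) ^+ 2 + G * be * (r2 * y2) ^+ 2); split.
  - by rewrite addr_ge0 // mulr_ge0 ?sqr_ge0 // ltW.
  - have := weighted_decay y1 y2 (ltW l1) (ltW Gbe) (expR_ge0 _)
      (_ : r2 <= r1).
    rewrite /V /weighted_sq -/y1 -/y2 !exprMn -!mulrA; apply.
    rewrite ler_expR ler_wpM2r ?subr_ge0 ?dw // lerN2; exact: ltW.
  have [g1 g2 _] := safe s sle.
  have := period_map_contracts (h * (r1 * y1)) (r2 * y2) al0 be0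
    (expR_gt0 (p2 * s)) (expR_gt0 (q2 * s)) G0 g1 g2.
  apply: le_trans.
  rewrite /V /weighted_sq z1 z2 le_eqVlt; apply/orP; left; apply/eqP.
  by rewrite -/G -hbd /h; ring.
have flee_le sigma d k t : admissible tau eta sigma d -> d k.*2.+1 <= t <= d k.*2.+2 ->
    0 <= t - d k.*2.+1 <= eta.
  move=> [_ _ _ fl] /andP[tk1 tk2]; rewrite subr_ge0 tk1 /=.
  by apply: le_trans (fl k); rewrite lerB.
have gap0 s : 0 <= s <= eta -> 0 <= gap s.
  by move=> /safe[g1 g2 _]; apply: mulr_ge0.
have r1le (r : R) : 0 <= r -> expR (- p1 * r) ^+ 2 <= 1.
  by move=> r0; rewrite expr_le1 ?expR_ge0 // -expR0 ler_expR mulNr oppr_le0 mulr_ge0 // ltW.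
have [m [C [m0 C0 VC Vm]]] := weighted_sq_equiv P1u l1 Gbe.
apply: (periodwise_lyapunov m0 C0 VC Vm).
  move=> sigma d x k t adm sol /andP[tk1 tk2].
  have [tk|/ltW tk] := leP t (d k.*2.+1); first by apply: dwell_dec adm sol _; rewrite tk1.
  have tkk : d k.*2.+1 <= t <= d k.*2.+2 by rewrite tk.
  have [W [W0 WV VW]] := flee_dec _ _ _ _ _ adm sol tkk.
  apply: le_trans VW _.
  have [_ _ dw _] := adm.
  apply: (@le_trans _ _ (1 * W)); first rewrite ler_wpM2r // gerBl divr_ge0 //.
    by rewrite gap0 // (flee_le _ _ _ _ adm).
  rewrite mul1r; apply: le_trans WV _; rewrite -[leRHS]mul1r ler_wpM2r //.
  by rewrite r1le // subr_ge0.
move=> e e0.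
(* The maximum keeps the interval nonempty when e > eta; no flee time is then
   at most eta - e. *)
pose b := Num.max 0 (eta - e).
have b0 : 0 <= b by rewrite le_max lexx.
have beta : b < eta by rewrite gt_max eta0 gtrBl.
have [c0] : exists2 c0, c0 \in `[0, b] & forall t, t \in `[0, b] -> gap c0 <= gap t.
  apply: EVT_min => //; apply: continuous_subspaceT => t.
  have ca := @continuous_expRM R p2 t.
  have cb := @continuous_expRM R q2 t.
  apply: cvgM.
    apply: cvgD; last by apply: cvgMr; exact: cvgB.
    apply: cvgM.
      by apply: cvgB; [exact: cvg_cst|exact: cvgMr].
    by apply: cvgD; [exact: cvg_cst|exact: cvgMr].
  apply: cvgB; last by apply: cvgMr; exact: cvgB.
  apply: cvgM.
    by apply: cvgD; [exact: cvg_cst|exact: cvgMr].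
  by apply: cvgB; [exact: cvg_cst|exact: cvgMr].
rewrite in_itv /= => /andP[c00 c0b] c0min.
have c0eta : c0 < eta by apply: le_lt_trans beta.
have gc0 : 0 < gap c0.
  have c0i : 0 <= c0 <= eta by rewrite c00 ltW.
  by have [_ _] := safe c0 c0i; apply.
exists (Num.max (expR (- p1 * e) ^+ 2) (1 - gap c0 / 2)).
  rewrite le_max sqr_ge0 /= gt_max gtrBl divr_gt0 // andbT.
  by rewrite expr_lt1 ?expR_ge0 // -expR0 ltr_expR mulNr oppr_lt0 mulr_gt0.
move=> sigma d x k adm sol short; have [[_ dlt _ _ _] _ dw fl] := adm.
have tkk : d k.*2.+1 <= d k.*2.+2 <= d k.*2.+2 by rewrite lexx ltW.
have [W [W0 WV VW]] := flee_dec _ _ _ _ _ adm sol tkk.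
apply: le_trans VW _; rewrite -/(flee d k).
have fli : 0 <= flee d k <= eta by rewrite (flee_le _ _ _ _ adm).
set c := Num.max _ _.
have ca : expR (- p1 * e) ^+ 2 <= c by rewrite le_max lexx.
have cb : 1 - gap c0 / 2 <= c by rewrite le_max lexx orbT.
have c_ge0 : 0 <= c by apply: le_trans ca; apply: sqr_ge0.
case: short => [long|short].
  apply: (@le_trans _ _ (1 * W)).
    by rewrite ler_wpM2r // gerBl divr_ge0 // gap0.
  rewrite mul1r; apply: le_trans WV _; rewrite ler_wpM2r //.
  apply: le_trans ca; rewrite ler_sqr ?nnegrE ?expR_ge0 // ler_expR !mulNr lerN2.
  by rewrite ler_pM2l // lerBrDl.
have WVk : W <= V (x (d k.*2)).
  apply: le_trans WV _; rewrite -[leRHS]mul1r ler_wpM2r //.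
  by rewrite r1le // subr_ge0.
apply: (@le_trans _ _ (c * W)); last by rewrite ler_wpM2l.
rewrite ler_wpM2r //; apply: le_trans cb.
rewrite lerB // ler_pM2r ?invr_gt0 //; apply: c0min.
rewrite in_itv /= le_max short orbT andbT.
by case/andP: fli.
Qed.

(** * Stability from the thresholds on *)

Theorem theorem4p3 (R : realType) (p1 q1 p2 q2 : R) (P1 P2 : 'M[R]_2)
    (eta : R) :
  let A1 := P1 *m diag2 (- p1) (- q1) *m invmx P1 in
  let A2 := P2 *m diag2 p2 q2 *m invmx P2 in
  let M := invmx P2 *m P1 in
  let a := M 0 0 in
  let b := M 0 1 in
  let c := M 1 0 in
  let d := M 1 1 in
  0 < p1 < q1 ->
  (0 < p2 < q2) \/ (p2 <= 0 < q2) ->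
  P1 \in unitmx -> P2 \in unitmx ->
  \det M = 1 ->
  (forall i j, M i j != 0) ->
  (a * b * c * d) / `|a * b * c * d| = 1 ->
  0 < eta ->
  (a * d < 0 ->
    exists2 tau : R,
      unique (fun t : R => 0 < t /\
        ((expR (q2 * eta - p1 * t) - 1) * (1 + expR (p2 * eta - q1 * t))) /
        ((expR (- p1 * t) + expR (- q1 * t)) *
         (expR (q2 * eta) - expR (p2 * eta))) = a * d) tau &
      stable_from (subsystem A1 A2) tau eta) /\
  (1 < a * d ->
    exists2 T : R,
      unique (fun t : R => 0 < t /\
        ((1 + expR (q2 * eta - p1 * t)) * (1 - expR (p2 * eta - q1 * t))) /
        ((expR (- p1 * t) + expR (- q1 * t)) *
         (expR (q2 * eta) - expR (p2 * eta))) = a * d) T &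
      stable_from (subsystem A1 A2) (Num.max (p2 / p1 * eta) T) eta).
Proof.
move=> A1 A2 M a b c d /andP[p0 pq] p2q2 P1u P2u det1 Mnz _ eta0.
have [q20 p2q] : 0 < q2 /\ p2 < q2.
  by case: p2q2 => /andP[h1 h2]; split=> //; lra.
have ac0 : a * c != 0 by rewrite mulf_neq0 ?Mnz.
pose E := expR (p2 * eta); pose F := expR (q2 * eta).
have E0 : 0 < E by apply: expR_gt0.
have EF : E < F by rewrite ltr_expR ltr_pM2r.
have F1 : 1 < F by rewrite -expR0 ltr_expR mulr_gt0.
have expB u v p t : expR (u * v - p * t) = expR (- p * t) * expR (u * v).
  by rewrite -expRD mulNr addrC.
have be0 t : 0 < expR (- q1 * t) by apply: expR_gt0.
have al0 t : 0 < expR (- p1 * t) by apply: expR_gt0.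
have beal t : 0 < t -> expR (- q1 * t) < expR (- p1 * t).
  by move=> t0; rewrite ltr_expR ltr_pM2r // ltrN2.
have al1 t : 0 < t -> expR (- p1 * t) < 1.
  by move=> t0; rewrite -expR0 ltr_expR mulNr oppr_lt0 mulr_gt0.
split=> [D0|D1].
- have [tau tauP] := threshold_pos p0 pq D0 E0 EF F1.
  have [[tau0 bal] _] := tauP.
  exists tau.
    apply: unique_iff tauP => t; rewrite !expB -/E -/F.
    by rewrite (ratio_gap_pos (a * d) (al0 t) (be0 t) EF).
  apply: stable_from_flee_safe => //; first by rewrite -/a -/d; nra.
  apply: flee_safe_neg => //; first exact: beal.
  by rewrite bal.
have [T TP] := threshold_neg p0 pq D1 E0 EF F1.
have [[T0 bal] _] := TP.
exists T.
  apply: unique_iff TP => t; rewrite !expB -/E -/F.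
  by rewrite (ratio_gap_neg (a * d) (al0 t) (be0 t) EF).
set tau := Num.max _ T.
have Ttau : T <= tau by rewrite le_max lexx orbT.
have tau0 : 0 < tau by apply: lt_le_trans Ttau.
apply: stable_from_flee_safe => //; first by rewrite -/a -/d; nra.
apply: flee_safe_pos => //; [exact: beal|exact: al1| |].
- rewrite -expRD -expR0 ler_expR mulNr addrC subr_le0.
  by rewrite -ler_pdivrMl // mulrA [_^-1 * _]mulrC le_max lexx.
move: Ttau; rewrite le_eqVlt => /predU1P[<-|Ttau]; first by rewrite bal.
by apply/ltW/(gap_neg_dwell_expR p0 pq D1 E0 EF Ttau); rewrite bal.
Qed.
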